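(* Let $Y=(Y^n)_{n\ge 1}$ be a sequence of centred Gaussian vectors $Y^n=(Y^{(n)}_1,\dots,Y^{(n)}_n)$ with finite energy. Then the quadratic variation $\langle Y\rangle=\lim_{n\to\infty}\sum_{k=1}^n (Y^{(n)}_k)^2$ exists as a limit in probability if and only if the sequence $(Y^n)_{n\ge1}$ has $2$-planar variation. In this case, the convergence holds also in $L^p$ for any number $p\ge 1$.
   Context: Each component $Y^{(n)}_k$ may depend on $n$. The energy of $Y$ is the limit $\varepsilon(Y):=\lim_{n\to\infty}\sum_{k=1}^n \mathbb{E}\left(Y^{(n)}_k\right)^2$, provided the limit exists; finite energy means that this limit exists and is finite. The sequence $Y$ has $2$-planar variation, defined as the limit $\Upsilon(Y):=\lim_{n,m\to\infty}\sum_{k=1}^n\sum_{j=1}^m\left[\mathbb{E}\left[Y^{(n)}_kY^{(m)}_j\right]\right]^2$, provided this limit exists.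
   Formalization: The Gaussian vectors are assumed jointly Gaussian across different n; if each Y^n is only Gaussian by itself the equivalence fails, e.g. for Y^n = (ε_n ξ, 0, …, 0) with ξ standard normal and independent random signs ε_n. *)

(* Defs.v *)
From HB Require Import structures.
From mathcomp Require Import all_boot all_order all_algebra.
From mathcomp Require Import all_classical all_reals all_analysis.

Set Implicit Arguments.
Unset Strict Implicit.
Unset Printing Implicit Defensive.

Import Order.TTheory GRing.Theory Num.Theory.
Import numFieldNormedType.Exports.

Local Open Scope classical_set_scope.
Local Open Scope ring_scope.

(* [normal_prob m 0] is by convention the uniform law on [0, 1], hence the
   separate treatment of degenerate Gaussian laws. *)
Definition gaussian_law (R : realType) (m s : R) : set R -> \bar R :=
  if s == 0 then \d_m else normal_prob m s.

Definition gaussian_var (d : measure_display) (T : measurableType d)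
    (R : realType) (P : probability T R) (X : T -> R) : Prop :=
  measurable_fun [set: T] X /\
  exists m s : R, forall B : set R, measurable B ->
    pushforward P X B = gaussian_law m s B.

Definition gaussian_family (d : measure_display) (T : measurableType d)
    (R : realType) (P : probability T R) (I : Type) (X : I -> {RV P >-> R}) :
    Prop :=
  forall (s : seq I) (c : I -> R),
    gaussian_var P (fun w => \sum_(i <- s) c i * X i w).

(* [Y n k] is the component of index k.+1 of the n-th vector; the n-th vector
   has n components, and the vector of index 0 is empty. The vectors are jointly
   Gaussian, across different n: the mixed moments E[Y^(n)_k Y^(m)_j] say
   nothing about quadratic variation if only each single vector is Gaussian. *)
Definition centred_gaussian_vectors (d : measure_display)
    (T : measurableType d) (R : realType) (P : probability T R)
    (Y : forall n : nat, 'I_n -> {RV P >-> R}) : Prop :=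
  gaussian_family (fun i : {n : nat & 'I_n} => Y (tag i) (tagged i)) /\
  forall (n : nat) (k : 'I_n), ('E_P[Y n k] = 0)%E.

Section quadratic_variation.
Context (d : measure_display) (T : measurableType d) (R : realType).
Context (P : probability T R) (Y : forall n : nat, 'I_n -> {RV P >-> R}).

Definition energy_sum (n : nat) : \bar R :=
  (\sum_(k < n) 'E_P[fun w => (Y k w ^+ 2)%R])%E.

Definition finite_energy : Prop :=
  cvgn energy_sum /\ limn energy_sum \is a fin_num.

Definition planar_sum (nm : nat * nat) : \bar R :=
  (\sum_(k < nm.1) \sum_(j < nm.2)
     'E_P[fun w => (Y k w * Y j w)%R] ^+ 2)%E.

(* The limit is taken in the extended reals; by Cauchy-Schwarz the planar sum is
   at most the product of the two energy sums, so it is finite under finite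
   energy. *)
Definition has_2planar_variation : Prop :=
  cvg (planar_sum nm @[nm --> (\oo, \oo)]).

Definition quad_sum (n : nat) (w : T) : R := \sum_(k < n) Y k w ^+ 2.

End quadratic_variation.

Definition cvg_in_probability (d : measure_display) (T : measurableType d)
    (R : realType) (P : probability T R) (V : nat -> T -> R)
    (X : {RV P >-> R}) : Prop :=
  forall e : R, 0 < e -> P [set w | e < `|V n w - X w|] @[n --> \oo] --> 0%E.

Definition cvg_in_Lp (d : measure_display) (T : measurableType d)
    (R : realType) (P : probability T R) (p : R) (V : nat -> T -> R)
    (X : {RV P >-> R}) : Prop :=
  [/\ forall n, V n \in Lfun P p%:E,
      (X : T -> R) \in Lfun P p%:E &
      'N[P]_(p%:E)[EFin \o (fun w => (V n w - X w)%R)]%E @[n --> \oo] --> 0%E].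

(* Main.v *)
Require Import Defs.
From HB Require Import structures.
From mathcomp Require Import all_boot all_order all_algebra.
From mathcomp Require Import all_classical all_reals all_analysis.
From mathcomp Require Import measurable_realfun.
From mathcomp Require Import ring lra.

Set Implicit Arguments.
Unset Strict Implicit.
Unset Printing Implicit Defensive.

Import Order.TTheory GRing.Theory Num.Theory.
Import numFieldNormedType.Exports.

Local Open Scope classical_set_scope.
Local Open Scope ring_scope.

(** Write [V n] for the sum of the squares of the components of the n-th vector,
    [e n] for its expectation, and [pl n m] for the double sum of the squared
    covariances. The equivalence comes from reading the double limit of the mixed
    moments E[V n * V m] in two ways.

    On the Gaussian side, Isserlis' formula for the pair formed by a component of
    the n-th vector and one of the m-th vector ([gaussian_isserlis]), summed over
    all such pairs, gives E[V n * V m] = c * (e n * e m + 2 * pl n m) with a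
    positive constant c. As [e n] converges to a finite limit, the 2-planar
    variation exists exactly when E[V n * V m] has a finite limit as n and m tend
    to infinity; a divergence of [pl] to infinity is excluded because the second
    moments of [V n] are bounded.

    On the probabilistic side, the square E[(V n - V m)^2] expands into mixed
    moments, so their convergence makes [V] a Cauchy sequence in mean square, and
    such a sequence has a limit in probability
    ([mixed_moments_cvg_in_probability]). Conversely, when every absolute moment
    of [V n] is bounded uniformly in n, convergence in probability to [QV] implies
    that [QV] has moments of all orders and that E|V n - QV|^k tends to 0 for all
    k ([cvg_in_probability_moments], [cvg_in_probability_cvg_moments]). This gives
    convergence in L^p for every p, and convergence of the mixed moments to
    E[QV^2] ([cvg_in_probability_cvg_Lp], [cvg_mixed_moments]).

    The uniform moment bounds hold because the 2k-th moment of a centred Gaussian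
    variable is a universal multiple of the k-th power of its variance
    ([gaussian_var_even_moment]); Jensen's inequality with weights slightly above
    the variances then bounds E[(V n)^k] by a multiple of (e n + 1)^k
    ([sum_gaussian_squares_moment_le]). *)

(** * Random variables with moments of all orders *)

Section all_moments.
Context (d : measure_display) (T : measurableType d) (R : realType).
Variable (P : probability T R).
Implicit Types (f g : T -> R).

(** The absolute powers are required to be integrable for all exponents at once
    because the class is then stable under sums and products, so that every
    integrability condition below reduces to closure properties. *)
Definition has_moments f : Prop := measurable_fun setT f /\
  forall n, P.-integrable setT (EFin \o (fun w => `|f w| ^+ n)).

Lemma le_integrable_EFin f g : measurable_fun setT f ->
  (forall w, `|f w| <= g w) -> P.-integrable setT (EFin \o g) ->
  P.-integrable setT (EFin \o f).
Proof.
move=> mf fg ig; apply: le_integrable ig => //; first exact/measurable_EFinP.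
by move=> w _ /=; rewrite lee_fin (le_trans (fg w))// ler_norm.
Qed.

Lemma integrable_EFinD f g : P.-integrable setT (EFin \o f) ->
  P.-integrable setT (EFin \o g) ->
  P.-integrable setT (EFin \o (fun w => f w + g w)).
Proof.
move=> fi gi.
by apply: eq_integrable (integrableD measurableT fi gi).
Qed.

Lemma integrable_EFinZ c f : P.-integrable setT (EFin \o f) ->
  P.-integrable setT (EFin \o (fun w => c * f w)).
Proof.
by move=> fi; apply: eq_integrable (integrableZl measurableT c fi).
Qed.

Lemma integrable_EFin_cst (c : R) : P.-integrable setT (EFin \o (fun _ : T => c)).
Proof. exact: finite_measure_integrable_cst. Qed.

Lemma Rintegral_prob_cst (c : R) : \int[P]_w c = c.
Proof. by rewrite Rintegral_cst//= probability_setT mulr1. Qed.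

Lemma moments_integrable f : has_moments f -> P.-integrable setT (EFin \o f).
Proof.
by move=> [mf /(_ 1%N)]; exact: le_integrable_EFin.
Qed.

Lemma integral_EFin_Rintegral (f : T -> R) : has_moments f ->
  (\int[P]_w (f w)%:E = (\int[P]_w f w)%:E)%E.
Proof.
move=> mf; rewrite /Rintegral fineK//.
by apply: integrable_fin_num => //; exact: moments_integrable.
Qed.

Lemma moments_cst c : has_moments (fun=> c).
Proof. by split=> [//|n]; exact: integrable_EFin_cst. Qed.

Lemma normrD_expr_le (x y : R) n :
  `|x + y| ^+ n <= 2 ^+ n * (`|x| ^+ n + `|y| ^+ n).
Proof.
have [xy|/ltW xy] := leP `|x| `|y|.
- apply: (@le_trans _ _ ((2 * `|y|) ^+ n)).
    rewrite lerXn2r ?nnegrE ?mulr_ge0// (le_trans (ler_normD _ _))//.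
    by rewrite mulr_natl mulr2n lerD2r.
  by rewrite exprMn ler_pM2l ?exprn_gt0// lerDr exprn_ge0.
- apply: (@le_trans _ _ ((2 * `|x|) ^+ n)).
    rewrite lerXn2r ?nnegrE ?mulr_ge0// (le_trans (ler_normD _ _))//.
    by rewrite mulr_natl mulr2n lerD2l.
  by rewrite exprMn ler_pM2l ?exprn_gt0// lerDl exprn_ge0.
Qed.

Lemma measurable_normX f n : measurable_fun setT f ->
  measurable_fun setT (fun w => `|f w| ^+ n).
Proof. by move=> mf; apply: measurable_funX; exact: measurableT_comp. Qed.

Lemma momentsD f g : has_moments f -> has_moments g -> has_moments (fun w => f w + g w).
Proof.
move=> [mf fi] [mg gi]; have mfg : measurable_fun setT (fun w => f w + g w).
  exact: measurable_funD.
split=> // n; apply: (@le_integrable_EFin _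
  (fun w => 2 ^+ n * (`|f w| ^+ n + `|g w| ^+ n))).
- exact: measurable_normX.
- by move=> w; rewrite ger0_norm ?exprn_ge0// normrD_expr_le.
- by apply: integrable_EFinZ; exact: integrable_EFinD.
Qed.

(** By 2ab <= a^2 + b^2, an n-th moment of a product is controlled by the 2n-th
    moments of its factors. *)
Lemma momentsM f g : has_moments f -> has_moments g -> has_moments (fun w => f w * g w).
Proof.
move=> [mf fi] [mg gi]; have mfg : measurable_fun setT (fun w => f w * g w).
  exact: measurable_funM.
split=> // n; apply: (@le_integrable_EFin _
  (fun w => `|f w| ^+ (n * 2) + `|g w| ^+ (n * 2))).
- exact: measurable_normX.
- move=> w; rewrite ger0_norm ?exprn_ge0// normrM exprMn !exprM.
  by set a := _ ^+ n; set b := _ ^+ n; nra.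
- exact: integrable_EFinD.
Qed.

Lemma momentsX f n : has_moments f -> has_moments (fun w => f w ^+ n).
Proof.
move=> mf; elim: n => [|n IHn]; first exact: moments_cst.
by under eq_fun do rewrite exprS; exact: momentsM.
Qed.

Lemma momentsZ c f : has_moments f -> has_moments (fun w => c * f w).
Proof. by apply: momentsM; exact: moments_cst. Qed.

Lemma momentsB f g : has_moments f -> has_moments g -> has_moments (fun w => f w - g w).
Proof.
move=> mf mg; under eq_fun do rewrite -mulN1r.
by apply: momentsD => //; exact: momentsZ.
Qed.

Lemma moments_norm f : has_moments f -> has_moments (fun w => `|f w|).
Proof.
move=> [mf fi]; split=> [|n]; first exact: measurableT_comp.
by under eq_fun do rewrite normr_id.
Qed.

Lemma moments_sum I (s : seq I) (F : I -> T -> R) :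
  (forall i, has_moments (F i)) -> has_moments (fun w => \sum_(i <- s) F i w).
Proof.
move=> mF; elim: s => [|i s IHs].
  by under eq_fun do rewrite big_nil; exact: moments_cst.
by under eq_fun do rewrite big_cons; exact: momentsD.
Qed.

End all_moments.

Section expectation.
Context (d : measure_display) (T : measurableType d) (R : realType).
Context (P : probability T R).
Implicit Types X Y : T -> R.

Lemma expectationRD X Y : has_moments P X -> has_moments P Y ->
  \int[P]_w (X w + Y w) = \int[P]_w X w + \int[P]_w Y w.
Proof. by move=> mX mY; apply: RintegralD => //; exact: moments_integrable. Qed.

Lemma expectationRZ c X : has_moments P X ->
  \int[P]_w (c * X w) = c * \int[P]_w X w.
Proof. by move=> mX; apply: RintegralZl => //; exact: moments_integrable. Qed.

Lemma expectationR_sum I (s : seq I) (F : I -> T -> R) :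
  (forall i, has_moments P (F i)) ->
  \int[P]_w (\sum_(i <- s) F i w) = \sum_(i <- s) \int[P]_w F i w.
Proof.
move=> mF; elim: s => [|i s IHs].
  rewrite big_nil; under eq_Rintegral do rewrite big_nil.
  exact: Rintegral_prob_cst.
rewrite big_cons -IHs -expectationRD//; last exact: moments_sum.
by apply: eq_Rintegral => w _; rewrite big_cons.
Qed.

Lemma expectationR_le X Y : has_moments P X -> has_moments P Y ->
  (forall w, X w <= Y w) -> \int[P]_w X w <= \int[P]_w Y w.
Proof.
by move=> mX mY XY; apply: le_Rintegral => //; exact: moments_integrable.
Qed.

Lemma moments_bounded (f : T -> R) c : measurable_fun setT f ->
  (forall w, `|f w| <= c) -> has_moments P f.
Proof.
move=> mf fc; split=> // n; apply: (@le_integrable_EFin _ _ _ _ _ (fun=> c ^+ n)).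
- exact: measurable_normX.
- move=> w; rewrite ger0_norm ?exprn_ge0// lerXn2r ?nnegrE//.
  exact: le_trans (fc w).
- exact: integrable_EFin_cst.
Qed.

Lemma moments_indic (A : set T) : measurable A -> has_moments P (\1_A : T -> R).
Proof.
move=> mA; apply: (@moments_bounded _ 1) => [|w]; first exact: measurable_indic.
by rewrite indicE; case: (_ \in _); rewrite ?normr1 ?normr0.
Qed.

Lemma expectationR_indic (A : set T) : measurable A ->
  (\int[P]_w (\1_A w : R))%:E = P A.
Proof.
move=> mA; rewrite /Rintegral integral_indic// setIT fineK//.
exact: fin_num_measure.
Qed.

End expectation.

(** * The normal law *)

Section normal_law.
Context (R : realType).
Local Notation mu := (@lebesgue_measure R).
Implicit Types (m s t x : R).

(** The normal law is defined by integrating its density over sets; uniqueness of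
    the Radon-Nikodym derivative extends this from indicators to all nonnegative
    functions. *)
Lemma ge0_integral_normal_prob m s (f : R -> \bar R) :
  measurable_fun setT f -> (forall x, (0 <= f x)%E) ->
  (\int[normal_prob m s]_x f x = \int[mu]_x (f x * (normal_pdf m s x)%:E))%E.
Proof.
move=> mf f0; have dom := normal_prob_dominates m s.
have mpdf : measurable_fun setT (fun x : measurableTypeR R => (normal_pdf m s x)%:E).
  by apply/measurable_EFinP; exact: measurable_normal_pdf.
have gi := Radon_Nikodym_SigmaFinite.f_integrable dom.
rewrite -(Radon_Nikodym_SigmaFinite.change_of_variables dom)//.
apply: ae_eq_integral => //.
- by apply: emeasurable_funM => //; exact: measurable_int gi.
- exact: emeasurable_funM.
- apply: ae_eqe_mul2l; apply: integral_ae_eq => // E _ mE.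
  by rewrite -(Radon_Nikodym_SigmaFinite.f_integral dom).
Qed.

(** Completing the square: tilting the density of the law of mean m by exp(t x)
    yields, up to a factor, the density of mean m + t s^2, whose mass is 1. *)
Lemma normal_prob_mgf m s t : s != 0 ->
  (\int[normal_prob m s]_x (expR (t * x))%:E =
   (expR (t * m + t ^+ 2 * s ^+ 2 / 2))%:E)%E.
Proof.
move=> s0; rewrite ge0_integral_normal_prob; first last.
- by move=> x; rewrite lee_fin expR_ge0.
- by apply/measurable_EFinP; exact: measurableT_comp.
transitivity (\int[mu]_x ((expR (t * m + t ^+ 2 * s ^+ 2 / 2))%:E *
    (normal_pdf (m + t * s ^+ 2) s x)%:E))%E; last first.
  rewrite ge0_integralZl//= ?integral_normal_pdf ?mule1//.
  - by apply/measurable_EFinP; exact: measurable_normal_pdf.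
  - by move=> x _; rewrite lee_fin normal_pdf_ge0.
apply: eq_integral => x _; rewrite -!EFinM !normal_pdfE//; congr EFin.
rewrite mulrCA [RHS]mulrCA /normal_fun -!expRD; congr (_ * expR _).
by field.
Qed.

(** Change of variables y = x / |s|, under which the two densities correspond. *)
Lemma normal_prob_scale s (f : R -> R) : s != 0 ->
  continuous f -> (forall x, 0 <= f x) ->
  (\int[normal_prob 0 s]_x (f x)%:E =
   \int[normal_prob 0 1]_x (f (`|s| * x))%:E)%E.
Proof.
move=> s0 cf f0.
have s_gt0 : 0 < `|s| by rewrite normr_gt0.
have cfs : continuous (fun x => f (`|s| * x)).
  move=> x; apply: continuous_comp; last exact: cf.
  exact: mulrl_continuous.
have mfE g : continuous g -> measurable_fun setT (EFin \o g : R -> \bar R).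
  by move=> cg; apply/measurable_EFinP; exact: continuous_measurable_fun.
rewrite ge0_integral_normal_prob; [|exact: mfE|by move=> x; rewrite lee_fin].
rewrite ge0_integral_normal_prob; [|exact: mfE|by move=> x; rewrite lee_fin].
under eq_integral do rewrite -EFinM.
pose F x := `|s| * x.
have dF x : is_derive x 1 F `|s|.
  by rewrite -[X in is_derive _ _ _ X]mulr1; exact: is_deriveZ.
have F'E : F^`()%classic = cst `|s|.
  by apply/funext => x; rewrite derive1E derive_val.
rewrite (@increasing_ge0_integration_by_substitutionT R F)//.
- apply: eq_integral => x _; rewrite F'E !fctE /F -EFinM; congr EFin.
  rewrite -mulrA; congr (_ * _); rewrite !normal_pdfE ?oner_eq0//.
  rewrite /normal_peak /normal_fun expr1n mul1r -mulrnAr sqrtrM ?sqr_ge0//.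
  rewrite sqrtr_sqr invfM !subr0 mulrAC mulrAC.
  have -> : - (`|s| * x) ^+ 2 / (s ^+ 2 *+ 2) = - x ^+ 2 / (1 *+ 2).
    rewrite exprMn real_normK ?num_real//; field.
    by rewrite s0.
  by rewrite mulrC !mulrA divff ?gt_eqF// mul1r.
- by move=> x y xy; rewrite /F ltr_pM2l.
- by rewrite F'E => ?; exact: cvg_cst.
- by rewrite F'E; exact: is_cvg_cst.
- by rewrite F'E; exact: is_cvg_cst.
- by apply/gt0_cvgMrNy => //; exact: cvg_id.
- by apply/gt0_cvgMry => //; exact: cvg_id.
- move=> x; apply: continuousM; first exact: cf.
  exact: continuous_normal_pdf.
- by move=> x; rewrite mulr_ge0 ?normal_pdf_ge0.
Qed.

End normal_law.

(** One term of the exponential series bounds every power, so that exponential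
    moments control all the others. *)
Lemma normr_expr_le_expR (R : realType) (x : R) n :
  `|x| ^+ n <= n`!%:R * (expR x + expR (- x)).
Proof.
have [->|n_gt0] := posnP n.
  rewrite expr0 fact0 mul1r; have := expR_ge1Dx x; have := expR_ge1Dx (- x).
  by lra.
have h (y : R) : 0 <= y -> y ^+ n <= n`!%:R * expR y.
  move=> y0; have := expR_ge1Dxn n.-1 y0; rewrite prednK// => h.
  rewrite mulrC -ler_pdivrMr ?ltr0n ?fact_gt0//.
  by apply: le_trans h; rewrite lerDr.
have [x0|x0] := leP 0 x.
- rewrite ger0_norm//; apply: (le_trans (h _ x0)).
  by rewrite ler_wpM2l// lerDl expR_ge0.
- have nx0 : 0 <= - x by rewrite oppr_ge0 ltW.
  rewrite ltr0_norm//; apply: (le_trans (h _ nx0)).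
  by rewrite ler_wpM2l// lerDr expR_ge0.
Qed.

Section gaussian_var_theory.
Context (d : measure_display) (T : measurableType d) (R : realType).
Context (P : probability T R) (X : {mfun T >-> R}) (m s : R).
Hypothesis lawX : forall B : set R, measurable B ->
  pushforward P X B = gaussian_law m s B.

Lemma gaussian_integral (f : R -> R) : measurable_fun setT f ->
  (forall x, 0 <= f x) ->
  (\int[P]_w (f (X w))%:E)%E =
  if s == 0 then (f m)%:E else (\int[normal_prob m s]_x (f x)%:E)%E.
Proof.
move=> mf f0.
have mF : measurable_fun setT (EFin \o f) by exact/measurable_EFinP.
have mX : measurable_fun setT (X : T -> measurableTypeR R).
  exact: (measurable_funPT X).
have mF' : @measurable_fun _ _ (measurableTypeR R) _ setT (EFin \o f).
  exact: mF.
pose X' : {mfun T >-> measurableTypeR R} :=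
  HB.pack (X : T -> measurableTypeR R) (isMeasurableFun.Build _ _ _ _ _ mX).
transitivity (\int[pushforward P X']_x (f x)%:E)%E.
  by rewrite ge0_integral_pushforward// => y _; rewrite lee_fin.
have [s0|s0] := eqVneq s 0.
  rewrite (eq_measure_integral (dirac (m : measurableTypeR R) : measure _ R)).
    by rewrite integral_dirac// diracT mul1e.
  by move=> A mA _; have := lawX mA; rewrite /gaussian_law s0 eqxx.
rewrite (eq_measure_integral (normal_prob m s : measure (measurableTypeR R) R))//.
by move=> A mA _; have := lawX mA; rewrite /gaussian_law (negbTE s0).
Qed.

(** The formula covers degenerate laws as well, because s = 0 gives exp(t m). *)
Lemma gaussian_mgf t :
  (\int[P]_w (expR (t * X w))%:E = (expR (t * m + t ^+ 2 * s ^+ 2 / 2))%:E)%E.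
Proof.
rewrite (@gaussian_integral (fun x => expR (t * x))); first last.
- by move=> x; exact: expR_ge0.
- exact: measurableT_comp.
have [->|s0] := eqVneq s 0; first by rewrite expr0n/= mulr0 mul0r addr0.
exact: normal_prob_mgf.
Qed.

Lemma gaussian_expR_integrable t :
  P.-integrable setT (EFin \o (fun w => expR (t * X w))).
Proof.
apply/integrableP; split.
  by apply/measurable_EFinP; apply: measurableT_comp => //; exact: measurable_funM.
under eq_integral do rewrite /= ger0_norm ?expR_ge0//.
by rewrite gaussian_mgf ltry.
Qed.

Lemma gaussian_moments : has_moments P X.
Proof.
split=> // n; apply: (@le_integrable_EFin _ _ _ _ _
    (fun w => n`!%:R * (expR (1 * X w) + expR (- 1 * X w)))).
- exact: measurable_normX.
- move=> w; rewrite ger0_norm ?exprn_ge0// mul1r mulN1r.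
  exact: normr_expr_le_expR.
- apply: integrable_EFinZ.
  by apply: integrable_EFinD; exact: gaussian_expR_integrable.
Qed.

(** Since exp(x) >= 1 + x, a variable of mean 0 has E[exp(t X)] >= 1 for all t,
    that is t m + t^2 s^2 / 2 >= 0 for all t, which forces m = 0. *)
Lemma gaussian_mean0 : \int[P]_w X w = 0 -> m = 0.
Proof.
move=> EX0.
have key t : 1 <= expR (t * m + t ^+ 2 * s ^+ 2 / 2).
  have -> : expR (t * m + t ^+ 2 * s ^+ 2 / 2) = \int[P]_w expR (t * X w).
    by rewrite /Rintegral gaussian_mgf.
  have Xi := moments_integrable gaussian_moments.
  have -> : 1 = \int[P]_w (1 + t * X w) :> R.
    rewrite RintegralD//; [|exact: integrable_EFin_cst|exact: integrable_EFinZ].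
    rewrite RintegralZl// EX0 mulr0 addr0.
    by rewrite Rintegral_prob_cst.
  apply: le_Rintegral => //; last by move=> w _; exact: expR_ge1Dx.
    by apply: integrable_EFinD; [exact: integrable_EFin_cst|exact: integrable_EFinZ].
  exact: gaussian_expR_integrable.
have {}key t : 0 <= t * m + t ^+ 2 * s ^+ 2 / 2.
  by have := key t; rewrite -[X in X <= _ -> _]expR0 ler_expR.
apply/eqP; rewrite -sqrf_eq0; apply/eqP.
have D0 : 0 < s ^+ 2 + 1 by rewrite ltr_wpDl ?sqr_ge0.
(* The minimizer -m / s^2 of the quadratic, perturbed to allow s = 0. *)
have := key (- m / (s ^+ 2 + 1)).
have -> : - m / (s ^+ 2 + 1) * m + (- m / (s ^+ 2 + 1)) ^+ 2 * s ^+ 2 / 2 =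
  - (m ^+ 2 * ((s ^+ 2 / 2 + 1) / (s ^+ 2 + 1) ^+ 2)) by field; rewrite gt_eqF.
rewrite oppr_ge0 pmulr_lle0; last first.
  by rewrite divr_gt0 ?exprn_gt0// ltr_wpDl// divr_ge0// sqr_ge0.
by move=> m2; apply/eqP; rewrite eq_le m2 sqr_ge0.
Qed.

End gaussian_var_theory.

(** The moment of order 2k, written as a moment of the square: this is the form in
    which it enters sums of squares. *)
Definition normal_even_moment (R : realType) (k : nat) : R :=
  \int[normal_prob 0 1]_x ((x ^+ 2) ^+ k).

Lemma normal_even_moment_ge0 (R : realType) k : 0 <= normal_even_moment R k.
Proof. by apply: Rintegral_ge0 => x _; rewrite exprn_ge0// sqr_ge0. Qed.

Section standard_normal_even_moments.
Context (R : realType).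
Let N : probability (measurableTypeR R) R := normal_prob (0 : R) 1.
Let mid : measurable_fun setT (idfun : measurableTypeR R -> R).
Proof. exact: measurable_id. Qed.
Let Z : {mfun measurableTypeR R >-> R} :=
  HB.pack (idfun : measurableTypeR R -> R) (isMeasurableFun.Build _ _ _ _ _ mid).

Let lawZ (B : set R) : measurable B -> pushforward N Z B = gaussian_law 0 1 B.
Proof. by move=> mB; rewrite /pushforward /gaussian_law oner_eq0. Qed.

Lemma standard_normal_has_moments :
  has_moments N (idfun : measurableTypeR R -> R).
Proof. exact: (gaussian_moments lawZ). Qed.

Lemma normal_even_moment_fin k :
  (\int[N]_x ((x ^+ 2) ^+ k)%:E = (normal_even_moment R k)%:E)%E.
Proof.
rewrite /normal_even_moment /Rintegral fineK//.
apply: integrable_fin_num => //; apply: moments_integrable.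
by apply: momentsX; apply: momentsX; exact: standard_normal_has_moments.
Qed.

Lemma normal_even_moment0 : normal_even_moment R 0 = 1.
Proof.
rewrite /normal_even_moment; under eq_Rintegral do rewrite expr0.
by rewrite Rintegral_prob_cst.
Qed.

(** If the second moment vanished, a standard normal variable would be 0 almost
    surely and its moment generating function would be 1 at 1, not exp(1/2). *)
Lemma normal_even_moment1_gt0 : 0 < normal_even_moment R 1.
Proof.
rewrite lt_neqAle normal_even_moment_ge0 andbT.
apply/negP => /eqP/esym m0.
have : (\int[N]_x (expR (1 * x))%:E = 1)%E.
  transitivity (\int[N]_x (cst 1 x))%E; last first.
    by rewrite integral_cst//= probability_setT mule1.
  apply: ae_eq_integral => //.
    by apply/measurable_EFinP; exact: measurableT_comp.
  have : ae_eq N setT (fun x => ((x ^+ 2) ^+ 1)%:E) (cst 0%E).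
    apply/(ae_eq_integral_abs N measurableT) => /=.
      by apply/measurable_EFinP; exact: measurable_funX.
    under eq_integral do rewrite ger0_norm ?sqr_ge0//.
    by rewrite normal_even_moment_fin m0.
  apply: filterS => x /= /(_ I) [] /eqP; rewrite expr1 sqrf_eq0 => /eqP -> _.
  by rewrite mulr0 expR0.
have := gaussian_mgf lawZ 1 => /= -> [].
rewrite !expr1n !mul1r add0r => e1.
by have := expR_gt1 (2^-1 : R); rewrite e1 ltxx invr_gt0 ltr0n.
Qed.

(** The variance of the squared variable is nonnegative, so the fourth moment is
    at least the square of the second one. *)
Lemma normal_even_moment2_gt0 : 0 < normal_even_moment R 2.
Proof.
have c0 := normal_even_moment1_gt0; set c := normal_even_moment R 1 in c0 *.
apply: (@lt_le_trans _ _ (c ^+ 2)); first exact: exprn_gt0.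
have mX k : N.-integrable setT (EFin \o (fun x : R => (x ^+ 2) ^+ k)).
  apply: moments_integrable; apply: momentsX; apply: momentsX.
  exact: standard_normal_has_moments.
rewrite -subr_ge0.
have -> : normal_even_moment R 2 - c ^+ 2 =
    \int[N]_x ((x ^+ 2) ^+ 2 + (- (2 * c) * (x ^+ 2) ^+ 1 + c ^+ 2)).
  rewrite RintegralD//; last first.
    apply: integrable_EFinD; first exact: integrable_EFinZ.
    exact: integrable_EFin_cst.
  rewrite RintegralD//; [|exact: integrable_EFinZ|exact: integrable_EFin_cst].
  rewrite RintegralZl// -/(normal_even_moment R 2) -/(normal_even_moment R 1) -/c.
  rewrite Rintegral_prob_cst; ring.
apply: Rintegral_ge0 => x _; rewrite expr1.
by rewrite [leRHS](_ : _ = (x ^+ 2 - c) ^+ 2) ?sqr_ge0//; ring.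
Qed.

End standard_normal_even_moments.

(** The common value of E[X^(2k)] / E[X^2]^k over all nondegenerate centred
    Gaussian variables X, that is (2k - 1)!!. *)
Definition gaussian_ratio (R : realType) (k : nat) : R :=
  normal_even_moment R k / normal_even_moment R 1 ^+ k.

Lemma gaussian_ratio2_gt0 (R : realType) : 0 < gaussian_ratio R 2.
Proof.
by rewrite divr_gt0 ?exprn_gt0 ?normal_even_moment1_gt0 ?normal_even_moment2_gt0.
Qed.

Lemma gaussian_ratio_ge0 (R : realType) k : 0 <= gaussian_ratio R k.
Proof. by rewrite divr_ge0 ?exprn_ge0// normal_even_moment_ge0. Qed.

Section centred_gaussian_var.
Context (d : measure_display) (T : measurableType d) (R : realType).
Context (P : probability T R) (X : T -> R).
Hypothesis gX : gaussian_var P X.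

Lemma gaussian_var_moments : has_moments P X.
Proof.
case: gX => mX [m [s law]].
pose mX' := isMeasurableFun.Build _ _ _ _ _ mX.
pose Y : {mfun T >-> R} := HB.pack X mX'.
exact: (@gaussian_moments _ _ _ P Y m s law).
Qed.

(** A centred Gaussian variable has the law of a multiple of a standard normal
    one, so its 2k-th moment is determined by its variance through scaling. *)
Lemma gaussian_var_even_moment k : \int[P]_w X w = 0 ->
  \int[P]_w ((X w ^+ 2) ^+ k) = gaussian_ratio R k * (\int[P]_w (X w ^+ 2)) ^+ k.
Proof.
case: gX => mX [m [s law]] EX0.
pose mX' := isMeasurableFun.Build _ _ _ _ _ mX.
pose Y : {mfun T >-> R} := HB.pack X mX'.
have law' : forall B : set R, measurable B ->
  pushforward P Y B = gaussian_law m s B by [].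
have m0 : m = 0 by exact: gaussian_mean0 law' EX0.
have mom j : \int[P]_w ((X w ^+ 2) ^+ j) = normal_even_moment R j * (s ^+ 2) ^+ j.
  rewrite /Rintegral.
  rewrite (gaussian_integral law' (f := fun x => (x ^+ 2) ^+ j)); first last.
  - by move=> x; rewrite exprn_ge0 ?sqr_ge0.
  - by apply: measurable_funX; exact: measurable_funX.
  rewrite m0; have [->|s0] := eqVneq s 0.
    rewrite expr0n/=; case: j => [|j].
      by rewrite !expr0 normal_even_moment0 mulr1.
    by rewrite !expr0n/= mulr0.
  rewrite (@normal_prob_scale _ _ (fun x => (x ^+ 2) ^+ j))//; first last.
  - by move=> x; rewrite exprn_ge0 ?sqr_ge0.
  - under eq_fun do rewrite -exprM; exact: exprn_continuous.
  have e x : ((`|s| * x) ^+ 2) ^+ j = (s ^+ 2) ^+ j * (x ^+ 2) ^+ j.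
    by rewrite -!exprM exprMn [`|s| ^+ _]exprM real_normK ?num_real// -exprM.
  under eq_integral do rewrite e EFinM.
  rewrite ge0_integralZl//; first last.
  - by rewrite lee_fin exprn_ge0 ?sqr_ge0.
  - by move=> x _; rewrite lee_fin exprn_ge0 ?sqr_ge0.
  - by apply/measurable_EFinP; apply: measurable_funX; exact: measurable_funX.
  by rewrite normal_even_moment_fin/= mulrC.
have := mom 1%N; under eq_Rintegral do rewrite expr1.
move=> ->; rewrite mom expr1 [(_ * _ ^+ 2) ^+ k]exprMn mulrA /gaussian_ratio divfK//.
by rewrite expf_neq0// gt_eqF// normal_even_moment1_gt0.
Qed.

End centred_gaussian_var.

Section isserlis.
Context (d : measure_display) (T : measurableType d) (R : realType).
Context (P : probability T R).
Implicit Types X Y : T -> R.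

(** Polarisation: 12 X^2 Y^2 = (X + Y)^4 + (X - Y)^4 - 2 X^4 - 2 Y^4, and the
    fourth moment of each of these Gaussian combinations is the same multiple,
    [gaussian_ratio R 2] = 3, of its squared variance. *)
Lemma gaussian_isserlis X Y :
  (forall a b, gaussian_var P (fun w => a * X w + b * Y w)) ->
  \int[P]_w X w = 0 -> \int[P]_w Y w = 0 ->
  \int[P]_w (X w ^+ 2 * Y w ^+ 2) = gaussian_ratio R 2 / 3 *
    (\int[P]_w (X w ^+ 2) * \int[P]_w (Y w ^+ 2) +
     2 * (\int[P]_w (X w * Y w)) ^+ 2).
Proof.
move=> gXY EX0 EY0.
have mX : has_moments P X.
  have := gaussian_var_moments (gXY 1 0).
  by under eq_fun do rewrite mul1r mul0r addr0.
have mY : has_moments P Y.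
  have := gaussian_var_moments (gXY 0 1).
  by under eq_fun do rewrite mul1r mul0r add0r.
have mXX := momentsX 2 mX; have mYY := momentsX 2 mY; have mXY := momentsM mX mY.
set a := \int[P]_w (X w ^+ 2); set b := \int[P]_w (Y w ^+ 2).
set c := \int[P]_w (X w * Y w).
have E2 u v : \int[P]_w ((u * X w + v * Y w) ^+ 2) =
    u ^+ 2 * a + (v ^+ 2 * b + 2 * u * v * c).
  rewrite -!expectationRZ// -!expectationRD//; do ?[exact: momentsZ | apply: momentsD].
  by apply: eq_Rintegral => w _; ring.
have E4 u v : \int[P]_w (((u * X w + v * Y w) ^+ 2) ^+ 2) =
    gaussian_ratio R 2 * (u ^+ 2 * a + (v ^+ 2 * b + 2 * u * v * c)) ^+ 2.
  rewrite gaussian_var_even_moment ?E2//.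
  by rewrite expectationRD ?expectationRZ ?EX0 ?EY0 ?mulr0 ?addr0//; exact: momentsZ.
have mL u v : has_moments P (fun w => ((u * X w + v * Y w) ^+ 2) ^+ 2).
  by apply: momentsX; apply: momentsX; apply: momentsD; exact: momentsZ.
transitivity (12^-1 * \int[P]_w (((1 * X w + 1 * Y w) ^+ 2) ^+ 2) +
  (12^-1 * \int[P]_w (((1 * X w + (-1) * Y w) ^+ 2) ^+ 2) +
  ((- 6^-1) * \int[P]_w (((1 * X w + 0 * Y w) ^+ 2) ^+ 2) +
   (- 6^-1) * \int[P]_w (((0 * X w + 1 * Y w) ^+ 2) ^+ 2)))).
  rewrite -!expectationRZ// -!expectationRD//; do ?[exact: momentsZ | apply: momentsD].
  by apply: eq_Rintegral => w _; field.
by rewrite !E4; field.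
Qed.

End isserlis.

(** * Moments of sums of squares of Gaussian variables *)

Section convexity.
Context (R : realFieldType).

(** The convex function u^(n+1) lies above its tangent at v. *)
Lemma exprn_tangent (u v : R) n : 0 <= u -> 0 <= v ->
  n.+1%:R * v ^+ n * u <= u ^+ n.+1 + n%:R * v ^+ n.+1.
Proof.
move=> u0 v0; elim: n => [|n IHn]; first by rewrite expr0 mulr1 mul1r mul0r addr0 expr1.
have h : 0 <= n.+1%:R * v ^+ n * (u - v) ^+ 2.
  by rewrite mulr_ge0 ?sqr_ge0// mulr_ge0 ?ler0n ?exprn_ge0.
have := ler_wpM2r u0 IHn.
rewrite -!natr1 !exprS in h * => {}IHn.
rewrite -subr_ge0; rewrite -subr_ge0 in IHn.
apply: le_trans (addr_ge0 IHn h) _; rewrite le_eqVlt; apply/orP; left; apply/eqP.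
ring.
Qed.

(** Sum, with weights a i, the tangent inequality for the ratios x i / a i at their
    weighted mean. *)
Lemma jensen_expr I (s : seq I) (a x : I -> R) n :
  (forall i, 0 < a i) -> (forall i, 0 <= x i) ->
  (\sum_(i <- s) x i) ^+ n.+1 <=
  (\sum_(i <- s) a i) ^+ n * \sum_(i <- s) a i * (x i / a i) ^+ n.+1.
Proof.
move=> a0 x0; set A := \sum_(i <- s) a i; set S := \sum_(i <- s) x i.
have S0 : 0 <= S by apply: sumr_ge0.
have : 0 <= A by apply: sumr_ge0 => i _; exact: ltW.
rewrite le_eqVlt => /orP[/eqP A0|A0].
  have : S = 0; last first.
    move=> ->; rewrite -A0 expr0n/= mulr_ge0 ?exprn_ge0// sumr_ge0// => i _.
    by rewrite mulr_ge0 ?(ltW (a0 _))// exprn_ge0// divr_ge0// ltW.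
  rewrite /S /A in A0 *; case: s A0 {S S0 A} => [|i s]; first by rewrite !big_nil.
  rewrite !big_cons => /eqP; rewrite lt_eqF// ltr_wpDr//.
  by apply: sumr_ge0 => j _; exact: ltW.
have v0 : 0 <= S / A by rewrite divr_ge0// ltW.
have : \sum_(i <- s) a i * (n.+1%:R * (S / A) ^+ n * (x i / a i)) <=
    \sum_(i <- s) a i * ((x i / a i) ^+ n.+1 + n%:R * (S / A) ^+ n.+1).
  apply: ler_sum => i _; rewrite ler_pM2l//; apply: exprn_tangent => //.
  by rewrite divr_ge0// ltW.
set C := n.+1%:R * _ ^+ n.
have e i : a i * (C * (x i / a i)) = x i * C by field; rewrite gt_eqF.
under eq_bigr do rewrite e.
under [X in _ <= X]eq_bigr do rewrite mulrDr.
rewrite -mulr_suml -/S big_split/= -mulr_suml -/A.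
set Q := \sum_(i <- s) _.
have -> : S * C = A * (n.+1%:R * (S / A) ^+ n.+1).
  by rewrite /C exprS; field; rewrite gt_eqF.
rewrite -lerBlDr -mulrBr -mulrBl -natr1 [_ + 1]addrC addrK mul1r => h.
have -> : S ^+ n.+1 = A ^+ n * (A * (S / A) ^+ n.+1).
  rewrite expr_div_n mulrA -exprSr mulrCA divff ?mulr1// expf_neq0//.
  exact: lt0r_neq0.
by rewrite ler_pM2l// exprn_gt0.
Qed.

End convexity.

Section gaussian_squares.
Context (d : measure_display) (T : measurableType d) (R : realType).
Context (P : probability T R).

(** Jensen's inequality with the variances as weights; each weight is raised by
    1 / (n + 1), at a total cost below 1, to keep it positive when a variance is
    zero. *)
Lemma sum_gaussian_squares_moment_le n (X : 'I_n -> T -> R) k :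
  (forall i, gaussian_var P (X i)) -> (forall i, \int[P]_w X i w = 0) ->
  \int[P]_w ((\sum_(i < n) X i w ^+ 2) ^+ k) <= gaussian_ratio R k *
    (\sum_(i < n) \int[P]_w (X i w ^+ 2) + 1) ^+ k.
Proof.
move=> gX EX0; case: k => [|k].
  by rewrite /gaussian_ratio !expr0 normal_even_moment0 Rintegral_prob_cst invr1 !mulr1.
have mX i := gaussian_var_moments (gX i).
pose b i := \int[P]_w (X i w ^+ 2); pose a i := b i + n.+1%:R^-1.
have b0 i : 0 <= b i by apply: Rintegral_ge0 => w _; exact: sqr_ge0.
have a0 i : 0 < a i by rewrite ltr_wpDl// invr_gt0.
pose A := \sum_(i < n) a i.
have A0 : 0 <= A by apply: sumr_ge0 => i _; exact: ltW.
have mS i c : has_moments P (fun w => c * (X i w ^+ 2) ^+ k.+1).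
  by apply: momentsZ; apply: momentsX; exact: momentsX.
apply: (@le_trans _ _ (\int[P]_w (\sum_(i < n)
    A ^+ k * (a i / a i ^+ k.+1) * (X i w ^+ 2) ^+ k.+1))).
  apply: expectationR_le.
  - by apply: momentsX; apply: moments_sum => i; exact: momentsX.
  - exact: moments_sum.
  - move=> w; apply: le_trans (jensen_expr _ _ a0 _) _.
      by move=> i; exact: sqr_ge0.
    rewrite big_distrr/= le_eqVlt; apply/orP; left; apply/eqP.
    by apply: eq_bigr => i _; rewrite expr_div_n; ring.
rewrite expectationR_sum//.
apply: (@le_trans _ _ (\sum_(i < n) A ^+ k * gaussian_ratio R k.+1 * a i)).
  apply: ler_sum => i _; rewrite expectationRZ; last first.
    by apply: momentsX; exact: momentsX.
  rewrite gaussian_var_even_moment// -/(b i).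
  move: (gaussian_ratio R k.+1) (gaussian_ratio_ge0 R k.+1) => G G0.
  have -> : A ^+ k * (a i / a i ^+ k.+1) * (G * b i ^+ k.+1) =
    A ^+ k * G * a i * (b i ^+ k.+1 / a i ^+ k.+1) by ring.
  rewrite ler_piMr ?mulr_ge0 ?exprn_ge0 ?(ltW (a0 _))//.
  rewrite ler_pdivrMr ?exprn_gt0// mul1r lerXn2r ?nnegrE ?(ltW (a0 _))//.
  by rewrite lerDl invr_ge0.
rewrite -mulr_sumr mulrAC -exprSr mulrC ler_wpM2l ?gaussian_ratio_ge0//.
have S0 : 0 <= \sum_(i < n) b i + 1 by rewrite addr_ge0// sumr_ge0.
rewrite lerXn2r ?nnegrE//.
rewrite /A big_split/= lerD2l sumr_const card_ord -[_ *+ n]mulr_natl.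
by rewrite ler_pdivrMr ?ltr0n// mul1r ler_nat.
Qed.

End gaussian_squares.

(** * Convergence in probability with bounded moments *)

Section convergence_in_probability.
Context (d : measure_display) (T : measurableType d) (R : realType).
Context (P : probability T R).

Lemma measurable_deviation (f : T -> R) e : measurable_fun setT f ->
  measurable [set w | e < `|f w|].
Proof.
move=> mf; rewrite -[X in measurable X]setTI.
have : measurable_fun setT (fun w => `|f w|) by exact: measurableT_comp.
move=> /(_ measurableT `]e, +oo[%classic (measurable_itv _)).
by congr (measurable _); apply/seteqP; split=> w /=; rewrite in_itv/= andbT.
Qed.

Lemma cvg_in_probability_lt (V : nat -> T -> R) (X : {RV P >-> R}) (e r : R) :
  cvg_in_probability V X -> 0 < e -> 0 < r ->
  \forall n \near \oo, (P [set w | (e < `|V n w - X w|)%R] < r%:E)%E.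
Proof.
move=> VX e0 r0; have /(_ [set x | (x < r%:E)%E]) := VX _ e0; apply.
by apply: open_ereal_lt'; rewrite lte_fin.
Qed.

(** The truncations min(|X|, K)^k have expectations bounded uniformly in K: on the
    event |V N - X| <= 1 by the moments of [V N], and elsewhere by K^k times a
    probability that is at most K^-k for N large. Monotone convergence then lets K
    tend to infinity. *)
Lemma cvg_in_probability_moments (V : nat -> T -> R) (X : {RV P >-> R}) :
  (forall n, has_moments P (V n)) ->
  (forall k, exists M, forall n, \int[P]_w (`|V n w| ^+ k) <= M) ->
  cvg_in_probability V X -> has_moments P X.
Proof.
move=> mV bV VX; split=> // k; have [M VM] := bV k.
set C := 2 ^+ k * (M + 1) + 1.
pose f (K : nat) w := Num.min `|X w| K%:R ^+ k.
have mm (K : nat) : measurable_fun setT (fun w => Num.min `|X w| K%:R).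
  by apply: measurable_minr => //; exact: measurableT_comp.
have min0 K w : 0 <= Num.min `|X w| K%:R by rewrite le_min normr_ge0 ler0n.
have mf K : has_moments P (f K).
  apply: momentsX; apply: (@moments_bounded _ _ _ _ _ K%:R) => // w.
  by rewrite ger0_norm// ge_min lexx orbT.
have fC K : \int[P]_w f K w <= C.
  have r0 : 0 < (K%:R ^+ k + 1)^-1 :> R.
    by rewrite invr_gt0 ltr_wpDl// exprn_ge0.
  have [N _ /(_ N (leqnn N)) /=] := cvg_in_probability_lt VX ltr01 r0.
  set A := [set w | _]; have mA : measurable A.
    by apply: measurable_deviation; apply: measurable_funB => //; case: (mV N).
  rewrite -expectationR_indic// lte_fin => PA.
  apply: (@le_trans _ _ (\int[P]_w (2 ^+ k * (`|V N w| ^+ k + 1) +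
      K%:R ^+ k * \1_A w))).
    apply: expectationR_le => //.
      apply: momentsD; apply: momentsZ; last exact: moments_indic.
      apply: momentsD; last exact: moments_cst.
      by apply: momentsX; exact: moments_norm.
    move=> w; rewrite indicE; have [wA|wA] := boolP (w \in A).
      rewrite mulr1 ler_wpDl//; last first.
        by rewrite lerXn2r ?nnegrE// ge_min lexx orbT.
    rewrite mulr0 addr0.
    have {}wA : `|V N w - X w| <= 1.
      by rewrite leNgt; apply: contra wA => wA; rewrite inE.
    apply: (@le_trans _ _ (`|X w| ^+ k)).
      by rewrite lerXn2r ?nnegrE// ge_min lexx.
    have -> : X w = V N w + - (V N w - X w) by rewrite opprB addrC subrK.
    apply: le_trans (normrD_expr_le _ _ _) _.
    by rewrite ler_pM2l ?exprn_gt0// lerD2l normrN exprn_ile1.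
  have mVk : has_moments P (fun w => `|V N w| ^+ k).
    by apply: momentsX; exact: moments_norm.
  rewrite expectationRD; first last.
  - by apply: momentsZ; exact: moments_indic.
  - by apply: momentsZ; apply: momentsD => //; exact: moments_cst.
  rewrite !expectationRZ; first last.
  - by apply: momentsD => //; exact: moments_cst.
  - exact: moments_indic.
  rewrite expectationRD//; last exact: moments_cst.
  rewrite Rintegral_prob_cst lerD//.
    by rewrite ler_pM2l ?exprn_gt0// lerD2r.
  have K0 : 0 <= K%:R ^+ k :> R by rewrite exprn_ge0.
  apply: (le_trans (ler_wpM2l K0 (ltW PA))).
  by rewrite ler_pdivrMr ?ltr_wpDl// mul1r lerDl.
apply/integrableP; split.
  by apply/measurable_EFinP; exact: measurable_normX.
under eq_integral do rewrite /= ger0_norm ?exprn_ge0//.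
apply: (@le_lt_trans _ _ C%:E); last exact: ltry.
have cf w : (f K w)%:E @[K --> \oo] --> (`|X w| ^+ k)%:E.
  apply: cvg_near_cst; exists (Num.truncn `|X w|).+1 => // K /= XK.
  rewrite /f min_l//; apply: ltW; apply: lt_le_trans (truncnS_gt _) _.
  by rewrite ler_nat.
rewrite (eq_integral (fun w => limn (fun K => (f K w)%:E))); last first.
  by move=> w _; apply/esym/cvg_lim => //; exact: cf.
rewrite monotone_convergence//; first last.
- move=> w _ K L KL; rewrite lee_fin lerXn2r ?nnegrE// le_min !ge_min lexx/=.
  by rewrite ler_nat KL orbT.
- by move=> K w _; rewrite lee_fin exprn_ge0.
- by move=> K; apply/measurable_EFinP; case: (mf K).
apply: lime_le.
  apply: ereal_nondecreasing_is_cvgn => K L KL; apply: ge0_le_integral => //.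
  - by move=> w _; rewrite lee_fin exprn_ge0.
  - by apply/measurable_EFinP; case: (mf K).
  - by apply/measurable_EFinP; case: (mf L).
  - move=> w _; rewrite lee_fin lerXn2r ?nnegrE// le_min !ge_min lexx/=.
    by rewrite ler_nat KL orbT.
apply: nearW => K; rewrite integral_EFin_Rintegral// lee_fin.
exact: fC.
Qed.

(** With D = V n - X and x = |D|^(k+1), the bound x <= a^(k+1) holds where
    |D| <= a, and x <= r x^2 + 1 / r holds everywhere. The expectation of x is thus
    small once a, then r, then the probability of |D| > a are small, because
    E[x^2] is bounded. *)
Lemma cvg_in_probability_cvg_moments (V : nat -> T -> R) (X : {RV P >-> R}) k :
  (forall n, has_moments P (V n)) ->
  (forall j, exists M, forall n, \int[P]_w (`|V n w| ^+ j) <= M) ->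
  cvg_in_probability V X ->
  \int[P]_w (`|V n w - X w| ^+ k.+1) @[n --> \oo] --> 0.
Proof.
move=> mV bV VX; have mX := cvg_in_probability_moments mV bV VX.
have [M VM] := bV (k.+1 * 2)%N.
pose M' := 2 ^+ (k.+1 * 2) * (M + \int[P]_w (`|X w| ^+ (k.+1 * 2))).
have mD n : has_moments P (fun w => V n w - X w) by exact: momentsB.
have mDk n j : has_moments P (fun w => `|V n w - X w| ^+ j).
  by apply: momentsX; exact: moments_norm.
have DM' n : \int[P]_w (`|V n w - X w| ^+ (k.+1 * 2)) <= M'.
  have mN f : has_moments P f -> has_moments P (fun w => `|f w| ^+ (k.+1 * 2)).
    by move=> mf; apply: momentsX; exact: moments_norm.
  apply: (@le_trans _ _ (\int[P]_w (2 ^+ (k.+1 * 2) *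
      (`|V n w| ^+ (k.+1 * 2) + `|X w| ^+ (k.+1 * 2))))).
    apply: expectationR_le => //; first by apply: momentsZ; apply: momentsD; exact: mN.
    by move=> w; rewrite -[`|X w|]normrN; exact: normrD_expr_le.
  rewrite expectationRZ; last by apply: momentsD; exact: mN.
  rewrite expectationRD; [|exact: mN..].
  by rewrite ler_pM2l ?exprn_gt0// lerD2r.
have M'0 : 0 <= M'.
  by apply: le_trans (DM' 0%N); apply: Rintegral_ge0 => w _; rewrite exprn_ge0.
apply/cvgr0Pnorm_le => e e0.
pose a := Num.min 1 (e / 3); pose r := e / (3 * (M' + 1)).
have a0 : 0 < a by rewrite lt_min ltr01 divr_gt0.
have M'1 : 0 < M' + 1 by rewrite ltr_wpDl.
have r0 : 0 < r by rewrite divr_gt0// mulr_gt0.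
have ak : a ^+ k.+1 <= e / 3.
  apply: (@le_trans _ _ a); last by rewrite ge_min lexx orbT.
  by rewrite exprS ler_piMr ?(ltW a0)// exprn_ile1 ?(ltW a0)// ge_min lexx.
have re0 : 0 < r * (e / 3) by rewrite mulr_gt0// divr_gt0.
apply: filterS (cvg_in_probability_lt VX a0 re0) => n.
set A := [set w | _]; have mA : measurable A.
  by apply: measurable_deviation; case: (mD n).
rewrite -expectationR_indic// lte_fin => PA.
rewrite ger0_norm; last by apply: Rintegral_ge0 => w _; rewrite exprn_ge0.
apply: (@le_trans _ _ (\int[P]_w (a ^+ k.+1 +
    (r * `|V n w - X w| ^+ (k.+1 * 2) + r^-1 * \1_A w)))).
  have mR : has_moments P (fun w => r * `|V n w - X w| ^+ (k.+1 * 2) + r^-1 * \1_A w).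
    by apply: momentsD; apply: momentsZ => //; exact: moments_indic.
  apply: expectationR_le => //; first by apply: momentsD => //; exact: moments_cst.
  move=> w; rewrite indicE exprM; set x := _ ^+ k.+1.
  have x0 : 0 <= x by rewrite exprn_ge0.
  have [wA|wA] := boolP (w \in A).
    rewrite mulr1 ler_wpDl ?exprn_ge0 ?(ltW a0)//.
    have -> : r * x ^+ 2 + r^-1 = x + r^-1 * ((r * x - 2^-1) ^+ 2 + 3 / 4).
      by field; rewrite gt_eqF.
    by rewrite lerDl mulr_ge0 ?invr_ge0 ?(ltW r0)// addr_ge0// sqr_ge0.
  rewrite mulr0 addr0 ler_wpDr//; first by rewrite mulr_ge0 ?sqr_ge0// ltW.
  rewrite lerXn2r ?nnegrE ?(ltW a0)// leNgt.
  by apply: contra wA => wA; rewrite inE.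
rewrite expectationRD; first last.
- by apply: momentsD; apply: momentsZ => //; exact: moments_indic.
- exact: moments_cst.
rewrite expectationRD; first last.
- by apply: momentsZ; exact: moments_indic.
- exact: momentsZ.
rewrite !expectationRZ//; last exact: moments_indic.
rewrite Rintegral_prob_cst.
have h1 : r * \int[P]_w (`|V n w - X w| ^+ (k.+1 * 2)) <= e / 3.
  apply: (le_trans (ler_wpM2l (ltW r0) (DM' n))).
  have <- : r * (M' + 1) = e / 3 by rewrite /r; field; rewrite gt_eqF.
  by rewrite ler_pM2l// lerDl.
have h2 : r^-1 * \int[P]_w (\1_A w) <= e / 3.
  by rewrite mulrC ler_pdivrMr// mulrC ltW.
by have := lerD ak (lerD h1 h2); lra.
Qed.

End convergence_in_probability.

(** * Convergence in probability of Cauchy sequences in mean square *)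

Section L2_completeness.
Context (d : measure_display) (T : measurableType d) (R : realType).
Context (P : probability T R).

(** The integral is taken in the extended reals, so that the inequality applies
    before f is known to be square integrable. *)
Lemma second_moment_markov (f : T -> R) e c : measurable_fun setT f -> 0 < e ->
  (\int[P]_w (f w ^+ 2)%:E <= c%:E)%E ->
  (P [set w | (e < `|f w|)%R] <= (c / e ^+ 2)%:E)%E.
Proof.
move=> mf e0 fc; set A := [set w | _]; have mA : measurable A.
  exact: measurable_deviation.
rewrite -expectationR_indic// lee_fin ler_pdivlMr ?exprn_gt0// -lee_fin.
apply: le_trans fc; rewrite mulrC -expectationRZ; last exact: moments_indic.
have mI : has_moments P (fun w => e ^+ 2 * \1_A w).
  by apply: momentsZ; exact: moments_indic.
rewrite -integral_EFin_Rintegral//; apply: ge0_le_integral => //.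
- by move=> w _; rewrite lee_fin mulr_ge0 ?exprn_ge0 ?(ltW e0)// indicE ler0n.
- by apply/measurable_EFinP; case: mI.
- by apply/measurable_EFinP; exact: measurable_funX.
- move=> w _; rewrite lee_fin indicE; have [wA|wA] := boolP (w \in A).
    rewrite mulr1 -(@real_normK _ (f w)) ?num_real// lerXn2r ?nnegrE ?(ltW e0)//.
    by move: wA; rewrite inE => /ltW.
  by rewrite mulr0 sqr_ge0.
Qed.

Lemma cvgn_of_summable_increments (u : nat -> R) :
  (\sum_(k <oo) (`|u k.+1 - u k|)%:E < +oo)%E -> cvgn u.
Proof.
move=> su; have st : cvgn (series (telescope u)).
  apply: normed_cvg; apply: nondecreasing_is_cvgn.
    by apply: nondecreasing_series => n _ _; exact: normr_ge0.
  exists (fine (\sum_(k <oo) (`|u k.+1 - u k|)%:E)) => _ [n _ <-].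
  rewrite -lee_fin fineK; last first.
    rewrite ge0_fin_numE//; apply: nneseries_ge0 => k _ _.
    by rewrite lee_fin.
  have -> : [normed series (telescope u)] n = \sum_(0 <= k < n) `|u k.+1 - u k| by [].
  rewrite -sumEFin.
  by apply: nneseries_lim_ge => k _ _; rewrite lee_fin.
rewrite (_ : u = fun n => u 0%N + series (telescope u) n); last first.
  by apply/funext => n; exact: eq_sum_telescope.
by apply: is_cvgD => //; exact: is_cvg_cst.
Qed.

(** A subsequence W whose increments are of order 2^-k in mean square has almost
    surely summable increments, hence converges almost surely. Its limit X
    satisfies E[(V n - X)^2] <= liminf E[(V n - W k)^2] by Fatou's lemma, and
    Markov's inequality concludes. *)
Lemma L2_cauchy_cvg_in_probability (V : nat -> T -> R) :
  (forall n, has_moments P (V n)) ->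
  (forall e, 0 < e -> exists N, forall n m, (N <= n)%N -> (N <= m)%N ->
     \int[P]_w ((V n w - V m w) ^+ 2) <= e) ->
  exists X : {RV P >-> R}, cvg_in_probability V X.
Proof.
move=> mV cauV.
have half_gt0 k : 0 < 2^-1 ^+ k :> R by rewrite exprn_gt0.
have /choice[f fP] k : exists N, forall n m, (N <= n)%N -> (N <= m)%N ->
    \int[P]_w ((V n w - V m w) ^+ 2) <= (2^-1 ^+ k) ^+ 2.
  by apply: cauV; rewrite exprn_gt0.
(* Partial sums make the extraction nondecreasing while dominating f. *)
pose g k := (\sum_(i < k.+1) f i)%N.
have fg k : (f k <= g k)%N by rewrite /g big_ord_recr leq_addl.
have fgS k : (f k <= g k.+1)%N.
  by rewrite (leq_trans (fg k))// /g [in leqRHS]big_ord_recr leq_addr.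
pose W k := V (g k).
have mB n m : has_moments P (fun w => V n w - V m w) by exact: momentsB.
have mW k : measurable_fun setT (W k) by case: (mV (g k)).
have mWB k : has_moments P (fun w => `|W k.+1 w - W k w|).
  by apply: moments_norm; exact: mB.
have EW k : \int[P]_w `|W k.+1 w - W k w| <= 2^-1 ^+ k.
  set h := 2^-1 ^+ k; have h0 : 0 < h := half_gt0 k.
  apply: (@le_trans _ _ (\int[P]_w (2^-1 * h +
     (2 * h)^-1 * (W k.+1 w - W k w) ^+ 2))).
    apply: expectationR_le => //.
      apply: momentsD; first exact: moments_cst.
      by apply: momentsZ; apply: momentsX; exact: mB.
    move=> w; rewrite -[(W k.+1 w - W k w) ^+ 2](real_normK (num_real _)); set x := `|_|.
    have -> : 2^-1 * h + (2 * h)^-1 * x ^+ 2 = x + (2 * h)^-1 * (x - h) ^+ 2.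
      by field; rewrite gt_eqF.
    by rewrite lerDl mulr_ge0 ?sqr_ge0// invr_ge0 mulr_ge0// ltW.
  rewrite expectationRD; first last.
  - by apply: momentsZ; apply: momentsX; exact: mB.
  - exact: moments_cst.
  rewrite Rintegral_prob_cst expectationRZ; last by apply: momentsX; exact: mB.
  have := fP k (g k.+1) (g k) (fgS k) (fg k); rewrite -/h => hP.
  have i0 : 0 <= (2 * h)^-1 by rewrite invr_ge0 mulr_ge0// ltW.
  have := ler_wpM2l i0 hP.
  have -> : (2 * h)^-1 * h ^+ 2 = 2^-1 * h by field; rewrite gt_eqF.
  by rewrite /W; lra.
pose S w := (\sum_(k <oo) (`|W k.+1 w - W k w|)%:E)%E.
have mWE k : measurable_fun setT (fun w => (`|W k.+1 w - W k w|)%:E).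
  by apply/measurable_EFinP; case: (mWB k).
have mS : measurable_fun setT S.
  by apply: ge0_emeasurable_sum => // k w _ _; rewrite lee_fin.
have S0 w : (0 <= S w)%E by apply: nneseries_ge0 => k _ _; rewrite lee_fin.
have iS : P.-integrable setT S.
  apply/integrableP; split=> //.
  under eq_integral do rewrite gee0_abs//.
  rewrite integral_nneseries//.
  apply: (@le_lt_trans _ _ (\sum_(k <oo) (2 / (2 ^ (k + 1))%:R)%:E)%E).
    apply: lee_nneseries => k _.
      by move=> _; apply: integral_ge0 => w _; rewrite lee_fin.
    rewrite integral_EFin_Rintegral// lee_fin; apply: le_trans (EW k) _.
    rewrite addn1 expnS natrM invfM mulrA divff// mul1r natrX exprVn//.
  have /cvg_lim := @cvg_geometric_eseries_half R 2 0.
  by rewrite /eseries/= => ->//; rewrite ltry.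
have cW : {ae P, forall w, cvgn (W ^~ w)}.
  apply: filterS (integrable_ae measurableT iS) => w /(_ I) Sw.
  by apply: cvgn_of_summable_increments; rewrite ltey_eq Sw.
(* The upper limit is measurable and agrees with the limit where it exists. *)
pose X w := fine (limn_esup (fun k => (W k w)%:E)).
have mX : measurable_fun setT X.
  apply: measurableT_comp => //.
  by apply: measurable_fun_limn_esup => k; exact/measurable_EFinP.
have XE w : cvgn (W ^~ w) -> W ^~ w @ \oo --> X w.
  move=> /cvg_ex[l Wl]; have EWl : (W k w)%:E @[k --> \oo] --> l%:E.
    by apply: cvg_EFin => //; exact: nearW.
  rewrite /X is_cvg_limn_esupE; last exact: cvgP EWl.
  by rewrite (cvg_lim _ EWl).
have key j n : (f j <= n)%N ->
    (\int[P]_w ((V n w - X w) ^+ 2)%:E <= ((2^-1 ^+ j) ^+ 2)%:E)%E.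
  move=> jn.
  have mVX : measurable_fun setT (fun w => ((V n w - X w) ^+ 2)%:E).
    apply/measurable_EFinP; apply: measurable_funX; apply: measurable_funB => //.
    by case: (mV n).
  pose F k w := ((V n w - W (k + j)%N w) ^+ 2)%:E.
  have mF k : measurable_fun setT (F k).
    apply/measurable_EFinP; apply: measurable_funX; apply: measurable_funB => //.
    by case: (mV n).
  have F0 k w : (0 <= F k w)%E by rewrite lee_fin sqr_ge0.
  rewrite (@ae_eq_integral _ _ _ _ setT (fun w => limn_einf (F ^~ w)))//; first last.
  - apply: filterS cW => w cw _.
    have FX : F ^~ w @ \oo --> ((V n w - X w) ^+ 2)%:E.
      apply: cvg_EFin; first exact: nearW.
      have WX : W (k + j)%N w @[k --> \oo] --> X w.
        by have := XE w cw; rewrite -(cvg_shiftn j).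
      have VWX : V n w - W (k + j)%N w @[k --> \oo] --> V n w - X w.
        by apply: cvgB => //; exact: cvg_cst.
      exact: (cvgM VWX VWX).
    rewrite limn_einf_lim; apply/esym/cvg_lim => //; exact: cvg_einfs.
  - rewrite (_ : (fun w => _) = (fun w => - limn_esup (fun k => - F k w))%E)//.
    apply: measurableT_comp => //; apply: measurable_fun_limn_esup => k.
    exact: measurableT_comp.
  apply: le_trans (fatou _ measurableT mF _) _ => //.
  rewrite limn_einf_lim; apply: lime_le; first exact: is_cvg_einfs.
  apply: nearW => k; apply: (@le_trans _ _ (\int[P]_w F k w)%E).
    by apply: ereal_inf_lbound; exists k => /=.
  rewrite /F integral_EFin_Rintegral; last by apply: momentsX; exact: mB.
  rewrite lee_fin; apply: fP => //; apply: leq_trans (fg j) _.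
  elim: k => [|k IHk]; first by rewrite add0n.
  by rewrite addSn (leq_trans IHk)// /g [in leqRHS]big_ord_recr leq_addr.
pose X' := isMeasurableFun.Build _ _ _ _ _ mX.
pose Y : {RV P >-> R} := HB.pack X X'.
exists Y => e e0; apply/fine_cvgP; split.
  by apply: nearW => n; apply: fin_num_measure; apply: measurable_deviation;
    apply: measurable_funB => //; case: (mV n).
apply/cvgr0Pnorm_le => r r0.
have re0 : 0 < r * e ^+ 2 by rewrite mulr_gt0// exprn_gt0.
have : geometric 1 (2^-1 : R) @ \oo --> 0.
  by apply: cvg_geometric; rewrite ger0_norm ?invr_ge0// invf_lt1// ltr1n.
move=> /cvgr0Pnorm_le /(_ _ re0) [j _ /(_ j (leqnn j))] /=.
rewrite mul1r ger0_norm ?(ltW (half_gt0 j))// => hj.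
exists (f j) => // n /= jn.
have mD : measurable_fun setT (fun w => V n w - X w).
  by apply: measurable_funB => //; case: (mV n).
have := second_moment_markov mD e0 (key _ _ jn).
have Pfin : P [set w | (e < `|V n w - X w|)%R] \is a fin_num.
  by apply: fin_num_measure; exact: measurable_deviation.
have P0 : 0 <= fine (P [set w | (e < `|V n w - X w|)%R]) by rewrite fine_ge0.
rewrite -(fineK Pfin) lee_fin ger0_norm//.
move=> /le_trans; apply; rewrite ler_pdivrMr ?exprn_gt0//.
apply: le_trans hj; rewrite expr2 ler_piMr ?(ltW (half_gt0 j))//.
by rewrite exprn_ile1// ?invr_ge0// invf_le1// ler1n.
Qed.

End L2_completeness.

(** * Mixed moments and convergence in L^p *)

Lemma normrM_le_sqr (R : realFieldType) (a b : R) :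
  `|a * b| <= 2^-1 * (a ^+ 2 + b ^+ 2).
Proof.
have := sqr_ge0 (a + b); have := sqr_ge0 (a - b).
by rewrite ler_norml => ? ?; apply/andP; split; nra.
Qed.

(** For x <= 1 the first term suffices, for x >= 1 the second one, whose exponent
    is an integer above p: real exponents thus reduce to integer ones. *)
Lemma powR_le_expr (R : realType) (x p : R) : 0 <= x -> 1 <= p ->
  x `^ p <= x + x ^+ (Num.truncn p).+1.
Proof.
move=> x0 p1; have [x1|x1] := leP x 1.
  rewrite ler_wpDr ?exprn_ge0//.
  have [->|xN0] := eqVneq x 0; first by rewrite powR0// gt_eqF// (lt_le_trans _ p1).
  by rewrite ge1r_powR// lt_neqAle eq_sym xN0 x0.
rewrite ler_wpDl// -powR_mulrn//; apply: ler_powR; first exact: ltW.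
by apply: ltW; exact: truncnS_gt.
Qed.

Section bounded_moments.
Context (d : measure_display) (T : measurableType d) (R : realType).
Context (P : probability T R).

Lemma moments_powR_le (f : T -> R) p : has_moments P f -> 1 <= p ->
  (\int[P]_w (`|f w| `^ p)%:E <=
   (\int[P]_w `|f w| + \int[P]_w (`|f w| ^+ (Num.truncn p).+1))%:E)%E.
Proof.
move=> mf p1; have mn := moments_norm mf; have mX := momentsX (Num.truncn p).+1 mn.
have mpow : measurable_fun setT (fun w => (`|f w| `^ p)%:E).
  apply/measurable_EFinP; apply: (measurableT_comp (measurable_powR _)) => //.
  by case: mn.
rewrite -expectationRD// -integral_EFin_Rintegral; last exact: momentsD.
apply: ge0_le_integral => //.
- by apply/measurable_EFinP; case: (momentsD mn mX).
- by move=> w _; rewrite lee_fin powR_le_expr.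
Qed.

Lemma LnormE (f : T -> R) p :
  ('N[P]_(p%:E)[EFin \o f] = (\int[P]_w (`|f w| `^ p)%:E) `^ p^-1)%E.
Proof. by rewrite unlock. Qed.

Lemma moments_Lfun (f : T -> R) p : has_moments P f -> 1 <= p ->
  f \in Lfun P p%:E.
Proof.
move=> mf p1; rewrite inE; apply/andP; split; rewrite inE/=; first by case: mf.
rewrite /finite_norm LnormE; apply: poweR_lty.
by apply: le_lt_trans (moments_powR_le mf p1) _; exact: ltry.
Qed.

Variable V : nat -> T -> R.
Hypothesis momV : forall n, has_moments P (V n).

Definition mixed_moment (nm : nat * nat) : R := \int[P]_w (V nm.1 w * V nm.2 w).

(** Loeve's criterion: E[(V n - V m)^2] is E[V n ^2] + E[V m ^2] - 2 E[V n * V m],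
    and the three terms are close to l, l and -2 l for n and m large. *)
Lemma mixed_moments_cvg_in_probability (l : R) :
  mixed_moment nm @[nm --> (\oo, \oo)] --> l ->
  exists QV : {RV P >-> R}, cvg_in_probability V QV.
Proof.
move=> ml; apply: L2_cauchy_cvg_in_probability => // e e0.
have e40 : 0 < e / 4 by rewrite divr_gt0.
move/cvgrPdist_le : ml => /(_ _ e40) [[A B] /= [[N1 _ AN] [N2 _ BN]] AB].
exists (maxn N1 N2) => n m; rewrite !geq_max => /andP[n1 n2] /andP[m1 m2].
have ml i j : (N1 <= i)%N -> (N2 <= j)%N ->
    `|l - \int[P]_w (V i w * V j w)| <= e / 4.
  by move=> iN jN; apply: (AB (i, j)); split; [exact: AN|exact: BN].
have mVV i j : has_moments P (fun w => V i w * V j w) by exact: momentsM.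
rewrite (_ : \int[P]_w _ = \int[P]_w (V n w * V n w) +
    (\int[P]_w (V m w * V m w) + (-2) * \int[P]_w (V n w * V m w))).
  have := ml n n n1 n2; have := ml m m m1 m2; have := ml n m n1 m2.
  by rewrite !ler_norml => /andP[? ?] /andP[? ?] /andP[? ?]; lra.
rewrite -expectationRZ// -expectationRD//; last exact: momentsZ.
rewrite -expectationRD//; last by apply: momentsD => //; exact: momentsZ.
by apply: eq_Rintegral => w _; ring.
Qed.

Hypothesis momV_bounded :
  forall k, exists M, forall n, \int[P]_w (`|V n w| ^+ k) <= M.

(** With D n = V n - QV, the difference V n * V m - QV^2 is
    D n * D m + QV * D n + QV * D m. Young's inequality with a small parameter r
    in front of QV^2 reduces its expectation to E[D n ^2] and E[D m ^2], which
    tend to 0. *)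
Lemma cvg_mixed_moments (QV : {RV P >-> R}) : cvg_in_probability V QV ->
  mixed_moment nm @[nm --> (\oo, \oo)] --> \int[P]_w (QV w ^+ 2).
Proof.
move=> VQ; have mQ := cvg_in_probability_moments momV momV_bounded VQ.
have D2 := @cvg_in_probability_cvg_moments _ _ _ P V QV 1 momV momV_bounded VQ.
pose D n w := V n w - QV w.
have mD n : has_moments P (D n) by exact: momentsB.
pose q := \int[P]_w (QV w ^+ 2).
have q0 : 0 <= q by apply: Rintegral_ge0 => w _; exact: sqr_ge0.
have q1 : 0 < q + 1 by rewrite ltr_wpDl.
apply/cvgrPdist_le => e e0.
pose r := e / (4 * (q + 1)).
have r0 : 0 < r by rewrite divr_gt0// mulr_gt0.
pose eta := Num.min (r * e / 4) (e / 4).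
have eta0 : 0 < eta by rewrite lt_min !divr_gt0// mulr_gt0.
move/cvgr0Pnorm_le : D2 => /(_ _ eta0)[N _ HN].
have {}HN n : (N <= n)%N -> \int[P]_w (D n w ^+ 2) <= eta.
  move=> /HN /=; rewrite ger0_norm; last first.
    by apply: Rintegral_ge0 => w _; rewrite exprn_ge0.
  by under eq_Rintegral do rewrite real_normK ?num_real//.
exists ([set n | (N <= n)%N], [set n | (N <= n)%N]).
  by split; exists N.
move=> [n m] [/= /HN nN /HN mN].
pose g n m w := D n w * D m w + (QV w * D n w + QV w * D m w).
have mg : has_moments P (g n m).
  by apply: momentsD; [exact: momentsM|apply: momentsD; exact: momentsM].
rewrite distrC.
have -> : mixed_moment (n, m) - \int[P]_w (QV w ^+ 2) = \int[P]_w g n m w.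
  rewrite -[- _]mulN1r -expectationRZ; last exact: momentsX.
  rewrite -expectationRD; first last.
  - by apply: momentsZ; exact: momentsX.
  - exact: momentsM.
  by apply: eq_Rintegral => w _; rewrite /g /D /=; ring.
apply: le_trans (le_normr_Rintegral _ _) _ => //; first exact: moments_integrable.
pose h w := 2^-1 * (D n w ^+ 2 + D m w ^+ 2) +
  (r * QV w ^+ 2 + (2 * r)^-1 * (D n w ^+ 2 + D m w ^+ 2)).
have mDD : has_moments P (fun w => D n w ^+ 2 + D m w ^+ 2).
  by apply: momentsD; exact: momentsX.
have mQ2 : has_moments P (fun w => QV w ^+ 2) by exact: momentsX.
apply: (@le_trans _ _ (\int[P]_w h w)).
  apply: expectationR_le; first exact: moments_norm.
    by apply: momentsD; [exact: momentsZ|apply: momentsD; exact: momentsZ].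
  move=> w; rewrite /g /h; set x := D n w; set y := D m w; set z := QV w.
  have -> : 2^-1 * (x ^+ 2 + y ^+ 2) + (r * z ^+ 2 + (2 * r)^-1 * (x ^+ 2 + y ^+ 2)) =
      2^-1 * (x ^+ 2 + y ^+ 2) +
      (2 * r)^-1 * (((r * z) ^+ 2 + x ^+ 2) + ((r * z) ^+ 2 + y ^+ 2)).
    by field; rewrite gt_eqF.
  apply: le_trans (ler_normD _ _) _; apply: lerD; first exact: normrM_le_sqr.
  rewrite [(2 * r)^-1 * _]mulrDr; apply: le_trans (ler_normD _ _) _.
  have young' b : `|z * b| <= (2 * r)^-1 * ((r * z) ^+ 2 + b ^+ 2).
    have := normrM_le_sqr (r * z) b; rewrite -mulrA normrM gtr0_norm//.
    by rewrite -ler_pdivlMl// mulrA -invfM [r * 2]mulrC.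
  exact: lerD.
rewrite expectationRD; first last.
- by apply: momentsD; exact: momentsZ.
- exact: momentsZ.
rewrite expectationRD; [|exact: momentsZ..].
rewrite !expectationRZ// expectationRD; [|exact: momentsX..].
set u := \int[P]_w (D n w ^+ 2) in nN *; set v := \int[P]_w (D m w ^+ 2) in mN *.
rewrite -/q.
have h1 : u + v <= 2 * (e / 4).
  by have := lerD nN mN; have : eta <= e / 4 by [rewrite ge_min lexx orbT]; lra.
have h2 : (2 * r)^-1 * (u + v) <= e / 4.
  have r20 : 0 < 2 * r by rewrite mulr_gt0.
  rewrite ler_pdivrMl//.
  have : eta <= r * e / 4 by rewrite ge_min lexx.
  by have := lerD nN mN; lra.
have h3 : r * q <= e / 4.
  have <- : r * (q + 1) = e / 4 by rewrite /r; field; rewrite gt_eqF.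
  by rewrite ler_pM2l// lerDl.
by lra.
Qed.

Lemma cvg_in_probability_cvg_Lp (QV : {RV P >-> R}) (p : R) :
  cvg_in_probability V QV -> 1 <= p ->
  cvg_in_Lp p V QV.
Proof.
move=> VQ p1; have mQ := cvg_in_probability_moments momV momV_bounded VQ.
have p0 : 0 < p by exact: lt_le_trans p1.
split=> [n||]; [exact: moments_Lfun|exact: moments_Lfun|].
have mD n : has_moments P (fun w => V n w - QV w) by exact: momentsB.
have D1 := @cvg_in_probability_cvg_moments _ _ _ P V QV 0 momV momV_bounded VQ.
have Dp := @cvg_in_probability_cvg_moments _ _ _ P V QV (Num.truncn p)
  momV momV_bounded VQ.
have intfin n : (\int[P]_w (`|V n w - QV w| `^ p)%:E)%E \is a fin_num.
  rewrite ge0_fin_numE; last by apply: integral_ge0 => w _; rewrite lee_fin powR_ge0.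
  by apply: le_lt_trans (moments_powR_le (mD n) p1) _; exact: ltry.
have NE n : ('N[P]_(p%:E)[EFin \o (fun w => (V n w - QV w)%R)] =
    ((\int[P]_w (`|V n w - QV w| `^ p)) `^ p^-1)%:E)%E.
  by rewrite LnormE -(fineK (intfin n)) poweR_EFin.
apply: cvg_EFin; first by apply: nearW => n; rewrite NE.
have /cvgr0Pnorm_le D0 : \int[P]_w (`|V n w - QV w| ^+ 1) +
    \int[P]_w (`|V n w - QV w| ^+ (Num.truncn p).+1) @[n --> \oo] --> 0.
  by rewrite -[0]addr0; exact: cvgD.
apply/cvgr0Pnorm_le => e e0; have ep0 : 0 < e `^ p by exact: powR_gt0.
apply: filterS (D0 _ ep0) => n /=; rewrite NE /= => Dn.
have i0 : 0 <= \int[P]_w (`|V n w - QV w| `^ p).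
  by apply: Rintegral_ge0 => w _; exact: powR_ge0.
rewrite ger0_norm ?powR_ge0//.
have -> : e = (e `^ p) `^ p^-1.
  by rewrite -powRrM mulfV ?gt_eqF// powRr1// ltW.
apply: ge0_ler_powR; rewrite ?nnegrE ?powR_ge0 ?invr_ge0 ?(ltW p0)//.
apply: le_trans (le_trans _ (ler_norm _)) Dn.
by rewrite -lee_fin {1}/Rintegral fineK//; exact: moments_powR_le.
Qed.

End bounded_moments.

(** * Quadratic variation of Gaussian vectors *)

Section quadratic_variation_proof.
Context (d : measure_display) (T : measurableType d) (R : realType).
Context (P : probability T R) (Y : forall n : nat, 'I_n -> {RV P >-> R}).
Hypothesis Y_gaussian : centred_gaussian_vectors Y.

Let V := quad_sum Y.
Let en n := \sum_(k < n) \int[P]_w (Y k w ^+ 2) : R.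
Let pl n m := \sum_(k < n) \sum_(j < m) (\int[P]_w (Y k w * Y j w)) ^+ 2 : R.

(** In [gaussian_family] the coefficients are attached to the indices, so that two
    coinciding components have to be merged and their coefficients added. *)
Let gaussianY2 n m (k : 'I_n) (j : 'I_m) a b :
  gaussian_var P (fun w => a * Y k w + b * Y j w).
Proof.
have [gY _] := Y_gaussian.
pose i1 : {n & 'I_n} := Tagged _ k; pose i2 : {n & 'I_n} := Tagged _ j.
have [ij|ij] := eqVneq i1 i2.
  have := gY [:: i1] (fun=> a + b); congr gaussian_var.
  apply/funext => w; rewrite big_seq1 mulrDl /=.
  suff : Y (tagged i1) w = Y (tagged i2) w by move=> /= ->.
  by rewrite ij.
have := gY [:: i1; i2] (fun i => if i == i1 then a else b); congr gaussian_var.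
apply/funext => w; rewrite big_cons big_seq1 eqxx eq_sym.
by rewrite (negbTE ij).
Qed.

Let gaussianY n (k : 'I_n) : gaussian_var P (Y k).
Proof.
have := gaussianY2 k k 1 0; congr gaussian_var.
by apply/funext => w; rewrite mul1r mul0r addr0.
Qed.

Let meanY n (k : 'I_n) : \int[P]_w Y k w = 0.
Proof.
have [_ /(_ n k)] := Y_gaussian.
by rewrite expectation_def /Rintegral => ->.
Qed.

Let momY n (k : 'I_n) : has_moments P (Y k) := gaussian_var_moments (gaussianY k).

Let momV n : has_moments P (V n).
Proof. by apply: moments_sum => k; exact: momentsX. Qed.

Let energy_sumE n : energy_sum Y n = (en n)%:E.
Proof.
rewrite /energy_sum /en -sumEFin; apply: eq_bigr => k _.
by rewrite unlock integral_EFin_Rintegral//; exact: momentsX.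
Qed.

Let planar_sumE nm : planar_sum Y nm = (pl nm.1 nm.2)%:E.
Proof.
rewrite /planar_sum /pl -sumEFin; apply: eq_bigr => k _.
rewrite -sumEFin; apply: eq_bigr => j _.
by rewrite unlock integral_EFin_Rintegral//; exact: momentsM.
Qed.

Let c := gaussian_ratio R 2 / 3.

Let c_gt0 : 0 < c. Proof. by rewrite divr_gt0// gaussian_ratio2_gt0. Qed.

(** Isserlis' formula summed over all pairs of components. *)
Let mixed_momentE n m :
  mixed_moment P V (n, m) = c * (en n * en m + 2 * pl n m).
Proof.
have mM k j : has_moments P (fun w => @Y n k w ^+ 2 * @Y m j w ^+ 2).
  by apply: momentsM; exact: momentsX.
transitivity (\int[P]_w (\sum_(k < n) \sum_(j < m) (Y k w ^+ 2 * Y j w ^+ 2))).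
  by apply: eq_Rintegral => w _; rewrite /V /quad_sum big_distrlr.
rewrite expectationR_sum; last by move=> k; exact: moments_sum.
under eq_bigr do rewrite expectationR_sum//.
rewrite /en /pl big_distrlr mulr_sumr -big_split mulr_sumr/=; apply: eq_bigr => k _.
rewrite mulr_sumr -big_split mulr_sumr/=; apply: eq_bigr => j _.
exact: gaussian_isserlis.
Qed.

Let en_ge0 n : 0 <= en n.
Proof. by apply: sumr_ge0 => k _; apply: Rintegral_ge0 => w _; exact: sqr_ge0. Qed.

Let pl_ge0 n m : 0 <= pl n m.
Proof. by apply: sumr_ge0 => k _; apply: sumr_ge0 => j _; exact: sqr_ge0. Qed.

Hypothesis Y_energy : finite_energy Y.

Let en_cvg : exists l : R, en n @[n --> \oo] --> l.
Proof.
have [cE lE] := Y_energy; exists (fine (limn (energy_sum Y))).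
have : energy_sum Y @ \oo --> (fine (limn (energy_sum Y)))%:E by rewrite fineK.
move=> /fine_cvg; rewrite (_ : fine \o energy_sum Y = en)//.
by apply/funext => n /=; rewrite energy_sumE.
Qed.

Let en_bounded : exists M, forall n, en n <= M.
Proof.
have [l el] := en_cvg; have [M [_ HM]] := cvg_seq_bounded (cvgP _ el).
exists (M + 1) => n; apply: le_trans (ler_norm _) _.
by apply: (HM (M + 1)) => //; rewrite ltrDl.
Qed.

Let momV_bounded k : exists M, forall n, \int[P]_w (`|V n w| ^+ k) <= M.
Proof.
have [M enM] := en_bounded; exists (gaussian_ratio R k * (M + 1) ^+ k) => n.
have V0 w : 0 <= V n w by apply: sumr_ge0 => i _; exact: sqr_ge0.
under eq_Rintegral do rewrite ger0_norm//.
apply: le_trans (sum_gaussian_squares_moment_le _ _ _) _ => //.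
rewrite ler_wpM2l ?gaussian_ratio_ge0// lerXn2r ?nnegrE ?lerD2r//.
  by rewrite addr_ge0// en_ge0.
- by rewrite addr_ge0// (le_trans (en_ge0 0)).
- exact: enM.
Qed.

Let mixed_cvg_planar (l : R) : mixed_moment P V nm @[nm --> (\oo, \oo)] --> l ->
  has_2planar_variation Y.
Proof.
move=> ml; have [e ee] := en_cvg.
apply: (@cvgP _ _ (2^-1 * (c^-1 * l - e * e))%:E).
apply: cvg_EFin; first by apply: nearW => nm; rewrite planar_sumE.
rewrite (_ : fine \o planar_sum Y =
    fun nm => 2^-1 * (c^-1 * mixed_moment P V nm - en nm.1 * en nm.2)); last first.
  apply/funext => nm /=; rewrite planar_sumE.
  rewrite [mixed_moment P V nm](mixed_momentE nm.1 nm.2) /=.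
  by field; rewrite gt_eqF.
have e1 : en nm.1 @[nm --> (\oo, \oo)] --> e by apply: cvg_comp ee; exact: cvg_fst.
have e2 : en nm.2 @[nm --> (\oo, \oo)] --> e by apply: cvg_comp ee; exact: cvg_snd.
apply: cvgM; first exact: cvg_cst.
apply: cvgB; last exact: cvgM.
by apply: cvgM => //; exact: cvg_cst.
Qed.

Let planar_mixed_cvg : has_2planar_variation Y ->
  exists l : R, mixed_moment P V nm @[nm --> (\oo, \oo)] --> l.
Proof.
move=> /cvg_ex[l pl_l]; have [e ee] := en_cvg.
have [M VM] := momV_bounded 2.
(* By 2ab <= a^2 + b^2 the mixed moments are at most M, so the planar sums stay
   bounded and their limit in the extended reals is finite. *)
have plM nm : pl nm.1 nm.2 <= c^-1 * M.
  rewrite ler_pdivlMl//; apply: (@le_trans _ _ (mixed_moment P V (nm.1, nm.2))).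
    rewrite mixed_momentE ler_pM2l//.
    have := pl_ge0 nm.1 nm.2; have := mulr_ge0 (en_ge0 nm.1) (en_ge0 nm.2).
    by lra.
  have mV2 n : has_moments P (fun w => `|V n w| ^+ 2).
    by apply: momentsX; exact: moments_norm.
  apply: (@le_trans _ _ (\int[P]_w (2^-1 * (`|V nm.1 w| ^+ 2 + `|V nm.2 w| ^+ 2)))).
    apply: expectationR_le; [exact: momentsM|by apply: momentsZ; exact: momentsD|].
    move=> w; rewrite !real_normK ?num_real//.
    exact: le_trans (ler_norm _) (normrM_le_sqr _ _).
  rewrite expectationRZ; last exact: momentsD.
  by rewrite expectationRD//; have := VM nm.1; have := VM nm.2; lra.
have l0 : (0 <= l)%E.
  apply: (cvge_ge _ pl_l); apply: nearW => nm.
  by rewrite planar_sumE lee_fin.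
have lM : (l <= (c^-1 * M)%:E)%E.
  apply: (cvge_le _ pl_l); apply: nearW => nm.
  by rewrite planar_sumE lee_fin.
have lfin : l \is a fin_num.
  by rewrite ge0_fin_numE// (le_lt_trans lM)// ltry.
rewrite -(fineK lfin) in pl_l; move: pl_l => /fine_cvg pl_l.
exists (c * (e * e + 2 * fine l)).
rewrite (_ : mixed_moment P V = fun nm =>
    c * (en nm.1 * en nm.2 + 2 * (fine \o planar_sum Y) nm)); last first.
  by apply/funext => nm /=; rewrite planar_sumE [LHS](mixed_momentE nm.1 nm.2).
have e1 : en nm.1 @[nm --> (\oo, \oo)] --> e by apply: cvg_comp ee; exact: cvg_fst.
have e2 : en nm.2 @[nm --> (\oo, \oo)] --> e by apply: cvg_comp ee; exact: cvg_snd.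
apply: cvgM; first exact: cvg_cst.
apply: cvgD; first exact: cvgM.
by apply: cvgM => //; exact: cvg_cst.
Qed.

Lemma quad_sum_cvg_iff_planar :
  (exists QV : {RV P >-> R}, cvg_in_probability (quad_sum Y) QV) <->
  has_2planar_variation Y.
Proof.
split=> [[QV VQ]|/planar_mixed_cvg[l ml]].
  exact: mixed_cvg_planar (cvg_mixed_moments momV momV_bounded VQ).
exact: (mixed_moments_cvg_in_probability momV ml).
Qed.

Lemma quad_sum_cvg_in_Lp (QV : {RV P >-> R}) (p : R) :
  cvg_in_probability (quad_sum Y) QV -> 1 <= p ->
  cvg_in_Lp p (quad_sum Y) QV.
Proof. exact: (cvg_in_probability_cvg_Lp momV momV_bounded). Qed.

End quadratic_variation_proof.

Theorem theorem2p1 (d : measure_display) (T : measurableType d)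
    (R : realType) (P : probability T R)
    (Y : forall n : nat, 'I_n -> {RV P >-> R})
    (Y_gaussian : centred_gaussian_vectors Y)
    (Y_energy : finite_energy Y) :
  ((exists QV : {RV P >-> R}, cvg_in_probability (quad_sum Y) QV) <->
   has_2planar_variation Y) /\
  (forall QV : {RV P >-> R}, cvg_in_probability (quad_sum Y) QV ->
   forall p : R, 1 <= p -> cvg_in_Lp p (quad_sum Y) QV).
Proof.
split; first exact: quad_sum_cvg_iff_planar.
by move=> QV VQ p p1; exact: quad_sum_cvg_in_Lp.
Qed.
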